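(* Let $\mathfrak{A}$ be a unital $\mathrm{C}^*$-algebra. Let $\mathfrak{S}$ and $\mathfrak{T}$ be self-adjoint subspaces of $\mathfrak{A}$ such that $\mathfrak{T}$ is unital. Assume that $\mathfrak{S}$ commutes with $\mathfrak{T}$. Then, the pair $(\mathfrak{S},\mathrm{C}^*(\mathfrak{T}))$ is unperforated.
   Context: $\mathrm{C}^*(\mathfrak{T})$ is the $\mathrm{C}^*$-subalgebra of $\mathfrak{A}$ generated by $\mathfrak{T}$; $\mathfrak{T}$ is unital if it contains the unit of $\mathfrak{A}$. $\mathfrak{S}$ commutes with $\mathfrak{T}$ if every element of $\mathfrak{S}$ commutes with every element of $\mathfrak{T}$. A pair $(\mathfrak{V},\mathfrak{W})$ of self-adjoint subspaces of a unital $\mathrm{C}^*$-algebra is unperforated if for every pair of self-adjoint elements $a\in\mathfrak{V}$, $b\in\mathfrak{W}$ with $a\le b$, there is a self-adjoint element $b'\in\mathfrak{W}$ such that $\|b'\|\le\|a\|$ and $a\le b'\le b$. *)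

(* Defs.v *)
From HB Require Import structures.
From mathcomp Require Import all_boot all_order all_algebra.
From mathcomp Require Import complex.
From mathcomp Require Import all_classical all_reals all_analysis.

Set Implicit Arguments.
Unset Strict Implicit.
Unset Printing Implicit Defensive.

Import Order.TTheory GRing.Theory Num.Theory.
Import numFieldNormedType.Exports.

Local Open Scope complex_scope.
Local Open Scope classical_set_scope.
Local Open Scope ring_scope.

(* The product and the unit are fields of the mixin because Hierarchy Builder
   cannot join [GRing.PzRing] with [CompleteNormedModule] (the normed ring
   structures below [Num.NumDomain] are missing).  They are packaged as a
   [pzRingType] right after, so that [x * y] and [1] are usable in every unital
   C*-algebra.  1 != 0 is not required: the zero C*-algebra is allowed. *)
HB.mixin Record isUnitalCStarAlgebra (R : realType) A
    of CompleteNormedModule R[i] A := {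
  cstar_one : A ;
  cstar_mul : A -> A -> A ;
  cstar_mulA : associative cstar_mul ;
  cstar_mul1 : left_id cstar_one cstar_mul ;
  cstar_mulr1 : right_id cstar_one cstar_mul ;
  cstar_mulDl : left_distributive cstar_mul +%R ;
  cstar_mulDr : right_distributive cstar_mul +%R ;
  cstar_scaleAl : forall (k : R[i]) (x y : A),
    k *: cstar_mul x y = cstar_mul (k *: x) y ;
  cstar_scaleAr : forall (k : R[i]) (x y : A),
    k *: cstar_mul x y = cstar_mul x (k *: y) ;
  cstar_normM : forall x y : A, `|cstar_mul x y| <= `|x| * `|y| ;
  star : A -> A ;
  starK : involutive star ;
  starD : {morph star : x y / x + y} ;
  starZ : forall (k : R[i]) (x : A), star (k *: x) = k^* *: star x ;
  starM : forall x y : A, star (cstar_mul x y) = cstar_mul (star y) (star x) ;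
  cstar_identity : forall x : A, `|cstar_mul (star x) x| = `|x| ^+ 2
}.

#[short(type="unitalCStarAlgType")]
HB.structure Definition UnitalCStarAlgebra (R : realType) :=
  {A of CompleteNormedModule R[i] A & isUnitalCStarAlgebra R A}.

HB.instance Definition _ (R : realType) (A : unitalCStarAlgType R) :=
  GRing.Zmodule_isPzRing.Build (UnitalCStarAlgebra.sort A)
    (@cstar_mulA R A) (@cstar_mul1 R A) (@cstar_mulr1 R A)
    (@cstar_mulDl R A) (@cstar_mulDr R A).

Section CStarAlgebra.
Context {R : realType} {A : unitalCStarAlgType R}.
Implicit Types (a b x y : A) (S T V W M : set A).

Definition selfadjoint a : Prop := star a = a.

Definition invertible a : Prop := exists b, a * b = 1 /\ b * a = 1.

Definition spectrum a : set R[i] := [set z | ~ invertible (a - z *: (1 : A))].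

(* On [R[i]], [0 <= z] says that z is a nonnegative real number. *)
Definition positive a : Prop :=
  selfadjoint a /\ spectrum a `<=` [set z | 0 <= z].

Definition cstar_le a b : Prop := positive (b - a).

Definition selfadjoint_subspace V : Prop :=
  GRing.submod_closed (mem V) /\ (forall a, V a -> V (star a)).

Definition cstar_subalgebra M : Prop :=
  [/\ selfadjoint_subspace M,
      (forall a b, M a -> M b -> M (a * b)) & closed M].

Definition cstar_generated T : set A := smallest cstar_subalgebra T.

Definition commutes_with S T : Prop :=
  forall s t, S s -> T t -> s * t = t * s.

Definition unperforated V W : Prop :=
  [/\ selfadjoint_subspace V, selfadjoint_subspace W &
      forall a b, V a -> selfadjoint a -> W b -> selfadjoint b ->
        cstar_le a b ->
        exists b', [/\ W b', selfadjoint b', `|b'| <= `|a|,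
                       cstar_le a b' & cstar_le b' b]].

End CStarAlgebra.

(* Main.v *)
Require Import Defs.
From mathcomp Require Import all_boot all_order all_algebra.
From mathcomp Require Import complex ring lra.
From mathcomp Require Import all_classical all_reals all_analysis.

Set Implicit Arguments.
Unset Strict Implicit.
Unset Printing Implicit Defensive.

Import Order.TTheory GRing.Theory Num.Theory.
Import numFieldNormedType.Exports.

Local Open Scope classical_set_scope.
Local Open Scope ring_scope.

(** The element [b'] is [f(b)] with [f(u) = min(u, |a|)], in other words
    [b' = (b + c - |b - c|) / 2] with [c = |a|] and [|x| = sqrt (x * x)].
    Since [S] commutes with [T], the commutant of [S] is a C*-algebra
    containing [T], so [a] commutes with [b] and with every element obtained
    from [b] by limits of polynomials.  On commuting elements the inequalities
    [a <= min(b, c) <= b] are those of real numbers: with [p = b - a >= 0] and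
    [q = c - a >= 0], twice [min(b, c) - a] is [p + q - |p - q|], which is
    nonnegative because [(p + q)^2 - (p - q)^2 = 4 p q >= 0].

    The functional calculus is replaced by an elementary theory of positive
    elements, with neither characters nor the spectral radius formula.  A
    self-adjoint [h] is called psd when [|t - h| <= t] for some real [t].
    - Square roots of psd elements ([psd_sqrt]) and inverses of elements
      close to a positive scalar ([inverse_near_sc]) are fixed points of maps
      dominated by a scalar map ([majorized_fixpoint]); they therefore lie in
      every closed subalgebra containing the data.
    - Squares are psd ([nrm_shift_sq]).  If [|k|^2 <= t], then [t - k^2] is
      psd, hence a square [g^2] with [g] commuting with [k], and
      [|g|^2 <= |g^2 + k^2| <= t] because [g + i k] is normal
      ([sa_sumsq]).  Thus psd elements are the squares of self-adjoint ones,
      and they form a closed cone stable under commuting products.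
    - This cone is the spectral one ([positive_psd], [psd_positive]).  If [h]
      has nonnegative spectrum, let [m] be the least [t >= 0] such that [h + t]
      is psd.  If [m > 0], then [h + m] is psd and invertible, so [h + m - e] is
      still psd for a small [e > 0] ([psd_unit_shift]), against minimality.
    - For commuting [k >= 0] and self-adjoint [x] with [x^2 <= k^2] one has
      [x <= k] ([psd_sub_of_sq]), which gives the order relations above. *)

(** * Real-valued norm and scalars *)

Section Norm.
Context {R : realType} {A : unitalCStarAlgType R}.
Implicit Types (x y z : A) (r s : R).

(** The norm of [A] has values in [R[i]]; working with its real part makes the
    linear arithmetic of the total order of [R] available. *)
Definition nrm x : R := complex.Re `|x|.

(** Scalars as central elements of the ring [A]: multiplication by [sc r] takes
    part in the ring identities, which a scaling would not, as the ring and
    module structures of [A] are not tied into one algebra structure. *)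
Definition sc r : A := r%:C%C *: (1 : A).

Lemma normE x : `|x| = (nrm x)%:C%C.
Proof. by rewrite /nrm RRe_real // ger0_real. Qed.

Lemma nrm_ge0 x : 0 <= nrm x.
Proof. by rewrite -ler0c -normE. Qed.

Lemma nrm0 : nrm 0 = 0.
Proof. by rewrite /nrm normr0. Qed.

Lemma nrm_eq0 x : nrm x = 0 -> x = 0.
Proof. by move=> x0; apply/eqP; rewrite -normr_eq0 normE x0. Qed.

Lemma nrmN x : nrm (- x) = nrm x.
Proof. by rewrite /nrm normrN. Qed.

Lemma nrmD x y : nrm (x + y) <= nrm x + nrm y.
Proof. by rewrite -lecR rmorphD /= -!normE ler_normD. Qed.

Lemma nrmB x y : nrm (x - y) <= nrm x + nrm y.
Proof. by rewrite -(nrmN y) nrmD. Qed.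

Lemma nrm_distC x y : nrm (x - y) = nrm (y - x).
Proof. by rewrite -nrmN opprB. Qed.

Lemma nrm_distD z x y : nrm (x - y) <= nrm (x - z) + nrm (z - y).
Proof. by rewrite -[x - y](subrKA z) nrmD. Qed.

Lemma nrmM x y : nrm (x * y) <= nrm x * nrm y.
Proof. by rewrite -lecR rmorphM /= -!normE; exact: cstar_normM. Qed.

Lemma nrm_cstar x : nrm (star x * x) = nrm x ^+ 2.
Proof.
by apply: complexI; rewrite rmorphXn /= -!normE; exact: cstar_identity.
Qed.

Lemma nrm_star x : nrm (star x) = nrm x.
Proof.
have le y : nrm y <= nrm (star y).
  have [->|y0] := eqVneq (nrm y) 0; first exact: nrm_ge0.
  have yp : 0 < nrm y by rewrite lt_neqAle eq_sym y0 nrm_ge0.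
  by rewrite -(ler_pM2r yp) -expr2 -nrm_cstar nrmM.
by apply/eqP; rewrite eq_le le andbT -{2}(starK x) le.
Qed.

Lemma nrm_sq_sa x : star x = x -> nrm (x * x) = nrm x ^+ 2.
Proof. by move=> sx; rewrite -nrm_cstar sx. Qed.

Lemma star0 : star (0 : A) = 0.
Proof. by apply: (addrI (star 0)); rewrite -starD !addr0. Qed.

Lemma starN x : star (- x) = - star x.
Proof. by apply/eqP; rewrite -subr_eq0 opprK -starD addNr star0. Qed.

Lemma starB x y : star (x - y) = star x - star y.
Proof. by rewrite starD starN. Qed.

Lemma star1 : star (1 : A) = 1.
Proof.
have sM x y : star (x * y) = star y * star x by exact: starM.
by rewrite -[RHS](starK 1) -(mulr1 (star 1)) sM starK mulr1.
Qed.

Lemma starMr x y : star (x * y) = star y * star x.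
Proof. exact: starM. Qed.

Lemma scale_mulE (c : R[i]) x : c *: x = (c *: (1 : A)) * x.
Proof. by rewrite -{1}[x]mul1r; exact: cstar_scaleAl. Qed.

Lemma scale1C (c : R[i]) x : (c *: (1 : A)) * x = x * (c *: (1 : A)).
Proof.
rewrite -scale_mulE -{1}[x]mulr1; exact: cstar_scaleAr.
Qed.

Lemma scE r x : sc r * x = r%:C%C *: x.
Proof. by rewrite -scale_mulE. Qed.

Lemma scC r x : sc r * x = x * sc r.
Proof. exact: scale1C. Qed.

Lemma scD r s : sc (r + s) = sc r + sc s.
Proof. by rewrite /sc rmorphD scalerDl. Qed.

Lemma scN r : sc (- r) = - sc r.
Proof. by rewrite /sc rmorphN scaleNr. Qed.

Lemma scB r s : sc (r - s) = sc r - sc s.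
Proof. by rewrite scD scN. Qed.

Lemma scM r s : sc (r * s) = sc r * sc s.
Proof. by rewrite scE /sc scalerA -rmorphM. Qed.

Lemma sc1 : sc 1 = 1.
Proof. by rewrite /sc scale1r. Qed.

Lemma sc0 : sc 0 = 0.
Proof. by rewrite /sc scale0r. Qed.

Lemma nrm_scM r x : nrm (sc r * x) = `|r| * nrm x.
Proof.
rewrite scE /nrm normrZ normE normc_def /= expr0n /= addr0 sqrtr_sqr.
by rewrite mul0r subr0.
Qed.

Lemma sc_double x : x + x = sc 2 * x.
Proof. by rewrite (_ : 2 = 1 + 1) // scD sc1 mulrDl mul1r. Qed.

(** Equality may fail: the zero algebra is allowed. *)
Lemma nrm1_le : nrm 1 <= 1.
Proof.
have := nrm_sq_sa star1; rewrite mulr1 => e.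
have [->|n0] := eqVneq (nrm 1) 0; first exact: ler01.
have : nrm 1 * nrm 1 = nrm 1 * 1 by rewrite -expr2 -e mulr1.
by move/(mulfI n0) ->.
Qed.

Lemma nrm_sc r : nrm (sc r) <= `|r|.
Proof. by rewrite -[sc r]mulr1 nrm_scM ler_piMr // nrm1_le. Qed.

Lemma nrm_sc_ge0 r : 0 <= r -> nrm (sc r) <= r.
Proof. by move=> r0; rewrite -{2}(ger0_norm r0) nrm_sc. Qed.

Lemma star_sc r : star (sc r) = sc r.
Proof.
rewrite /sc starZ star1; congr (_ *: _).
by apply/eqP; rewrite eq_complex /= oppr0 !eqxx.
Qed.

End Norm.

(** * Closed sets and fixed points *)

Section FixedPoints.
Context {R : realType} {A : unitalCStarAlgType R}.
Implicit Types (x y : A) (s t : R) (M : set A).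

Lemma gt0_complexE (e : R[i]) : 0 < e ->
  0 < complex.Re e /\ e = (complex.Re e)%:C%C.
Proof.
move=> e0; have eE : e = (complex.Re e)%:C%C by rewrite RRe_real // gtr0_real.
by split=> //; rewrite -ltcR -eE.
Qed.

Lemma closed_approx M x : closed M ->
  (forall e, 0 < e -> exists y, M y /\ nrm (x - y) < e) -> M x.
Proof.
move=> Mc Mx; apply: Mc => B /nbhs_normP [e /= /gt0_complexE [e0 eE] Be].
have [y [My xy]] := Mx _ e0; exists y; split=> //; apply: Be => /=.
by rewrite eE normE ltcR.
Qed.

Lemma approx_closed M :
  (forall x, (forall e, 0 < e -> exists y, M y /\ nrm (x - y) < e) -> M x) ->
  closed M.
Proof.
move=> HM x Mx; apply: HM => e e0.
have /Mx [y [My xy]] : nbhs x [set y | nrm (x - y) < e].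
  apply/nbhs_normP; exists e%:C%C; first by rewrite /= ltcR.
  by move=> y /=; rewrite normE ltcR.
by exists y.
Qed.

(** [L] is additive and bounded, hence continuous. *)
Lemma closed_zeros (L : A -> A) (C : R) : (forall x y, L (x - y) = L x - L y) ->
  (forall x, nrm (L x) <= C * nrm x) -> closed [set x | L x = 0].
Proof.
move=> LB LC; apply: approx_closed => x Hx /=; apply: nrm_eq0.
apply/eqP; rewrite eq_le nrm_ge0 andbT.
apply/ler_addgt0Pl => e e0; rewrite addr0.
have C0 : 0 < `|C| + 1 by rewrite ltr_wpDl.
have [|y [Ly xy]] := Hx (e / (`|C| + 1)); first by rewrite divr_gt0.
have -> : L x = L (x - y) by rewrite LB Ly subr0.
apply: (le_trans (LC _)); move: xy; rewrite ltr_pdivlMr // => xy.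
have := ler_norm C; have := nrm_ge0 (x - y); nra.
Qed.

Lemma complete_nrm (u : nat -> A) :
  (forall e, 0 < e -> exists N, forall n, (N <= n)%N -> nrm (u N - u n) < e) ->
  exists l, forall e, 0 < e ->
    exists N, forall n, (N <= n)%N -> nrm (l - u n) < e.
Proof.
move=> uC.
have /cvg_ex [l ul] : cvg (u @ \oo).
  apply: cauchy_cvg; apply: cauchy_exP => e /gt0_complexE [e0 ->].
  have [N uN] := uC _ e0; exists (u N); exists N => // n /= Nn.
  by rewrite -ball_normE /= normE ltcR uN.
exists l => e e0; move/cvgrPdist_lt : ul => /(_ e%:C%C).
rewrite ltcR => /(_ e0) [N _ uN]; exists N => n Nn.
by have := uN n Nn; rewrite /= normE ltcR.
Qed.

(** Kantorovich's majorant principle.  The increments of the iterates of [phi]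
    from [0] are bounded by those of the iterates of [rho] from [0], which
    increase and are bounded by [B]; so the iterates of [phi] converge although
    [phi] need not be a contraction (for square roots [C = 1]).  Every closed
    set stable under [phi] and containing [0] contains the limit: commutation,
    self-adjointness and membership in a subalgebra are obtained this way. *)
Lemma majorized_fixpoint (phi : A -> A) (rho : R -> R) (B C : R) :
  0 <= B ->
  (forall s, 0 <= s <= B -> 0 <= rho s <= B) ->
  nrm (phi 0) <= rho 0 ->
  (forall x y s t, nrm y <= t -> nrm (x - y) <= s - t ->
     0 <= t <= B -> 0 <= s <= B -> nrm (phi x - phi y) <= rho s - rho t) ->
  (forall x y, nrm x <= B -> nrm y <= B ->
     nrm (phi x - phi y) <= C * nrm (x - y)) ->
  exists z, [/\ phi z = z, nrm z <= B &
    forall M, closed M -> M 0 -> (forall x, M x -> M (phi x)) -> M z].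
Proof.
move=> B0 rhoB phi0 phirho phiC.
pose u n := iter n phi 0; pose r n := iter n rho 0.
have rB n : 0 <= r n <= B by elim: n => [|n IH] /=; [rewrite lexx|exact: rhoB].
have ur n : nrm (u n) <= r n /\ nrm (u n.+1 - u n) <= r n.+1 - r n.
  elim: n => [|n [IH1 IH2]]; first by rewrite /= nrm0 !subr0.
  split; first by have := nrmD (u n.+1 - u n) (u n); rewrite subrK; lra.
  exact: phirho IH1 IH2 (rB n) (rB n.+1).
have uB n : nrm (u n) <= B by have [] := ur n; have := rB n; lra.
have urm n m : nrm (u n - u (n + m)%N) <= r (n + m)%N - r n.
  elim: m => [|m IH]; first by rewrite addn0 !subrr nrm0.
  have := nrm_distD (u (n + m)%N) (u n) (u (n + m.+1)%N).
  rewrite addnS; have [_] := ur (n + m)%N; rewrite (nrm_distC (u _.+1)); lra.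
have [|l ul] := @complete_nrm u.
  move=> e e0.
  pose E := [set r n | n in [set: nat]].
  have supE : has_sup E.
    by split; [exists (r 0%N), 0%N | exists B => _ [n _ <-]; have := rB n; lra].
  have [_ [N _ <-] rN] := sup_adherent e0 supE.
  exists N => n Nn; rewrite -(subnKC Nn); apply: le_lt_trans (urm _ _) _.
  have : r (N + (n - N))%N <= sup E; last by lra.
  by apply: ub_le_sup; [case: supE|exists (N + (n - N))%N].
have Mlim M : closed M -> (forall n, M (u n)) -> M l.
  move=> Mc Mu; apply: closed_approx Mc _ => e /ul [N uN].
  by exists (u N); split=> //; apply: uN.
have lB : nrm l <= B.
  apply/ler_addgt0Pl => e /ul [N /(_ N (leqnn _))] lN.
  by have := nrmD (l - u N) (u N); rewrite subrK; have := uB N; lra.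
exists l; split=> //; last first.
  move=> M Mc M0 Mphi; apply: Mlim => // n.
  by elim: n => //= n; exact: Mphi.
apply/eqP; rewrite -subr_eq0; apply/eqP/nrm_eq0/eqP.
rewrite eq_le nrm_ge0 andbT.
apply/ler_addgt0Pl => e e0; rewrite addr0.
have C0 : 0 < `|C| + 1 by rewrite ltr_wpDl.
set d := e / (`|C| + 1).
have dE : d * (`|C| + 1) = e by rewrite divfK // gt_eqF.
have [|N uN] := ul d; first by rewrite divr_gt0.
have := uN N.+1 (leqnSn _); have := uN N (leqnn _) => uN0 uN1.
have := phiC l (u N) lB (uB N); have := nrm_distD (u N.+1) (phi l) l.
rewrite (nrm_distC (u N.+1) l) => tri /le_trans.
move=> /(_ _ (ler_wpM2r (nrm_ge0 _) (ler_norm C))).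
have := ler_wpM2l (normr_ge0 C) (ltW uN0); move: tri => /=; lra.
Qed.

End FixedPoints.

(** * Square roots and inverses *)

Section SquareRoots.
Context {R : realType} {A : unitalCStarAlgType R}.
Implicit Types (x y z h k w : A) (r s t : R) (M : set A).

Definition real_subalgebra M :=
  [/\ closed M, forall r, M (sc r), forall x y, M x -> M y -> M (x + y)
    & forall x y, M x -> M y -> M (x * y)].

(** Norm form of positivity: the spectrum lies in a disc centred at [t] and of
    radius [t], and it is real. *)
Definition psd h := star h = h /\ exists t, nrm (sc t - h) <= t.

Lemma real_subalgebraB M x y :
  real_subalgebra M -> M x -> M y -> M (x - y).
Proof.
move=> [_ Msc MD MM] Mx My; apply: MD => //.
by rewrite -[- y]mul1r mulrN -mulNr -sc1 -scN; exact: MM.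
Qed.

Lemma closed_sa : closed [set x : A | star x = x].
Proof.
rewrite (_ : [set x | _] = [set x : A | star x - x = 0]); last first.
  apply/seteqP; split=> x /= e; first by rewrite e subrr.
  by apply/eqP; rewrite -subr_eq0 e.
apply: (@closed_zeros _ _ _ 2) => [x y|x].
  by rewrite starB !opprD !addrA; congr (_ + _); rewrite addrAC.
by have := nrmB (star x) x; rewrite nrm_star; lra.
Qed.

Lemma closed_commutant x : closed [set y : A | GRing.comm x y].
Proof.
rewrite (_ : [set y | _] = [set y : A | x * y - y * x = 0]); last first.
  apply/seteqP; split=> y /= e; first by rewrite e subrr.
  by apply/eqP; rewrite -subr_eq0 e.
apply: (@closed_zeros _ _ _ (2 * nrm x)) => [y z|y].
  by rewrite mulrBr mulrBl !opprD !addrA; congr (_ + _); rewrite addrAC.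
by have := nrmB (x * y) (y * x); have := nrmM x y; have := nrmM y x; lra.
Qed.

Lemma comm_sc x r : GRing.comm x (sc r).
Proof. by rewrite /GRing.comm scC. Qed.

Lemma commutant_subalgebra x : real_subalgebra [set y | GRing.comm x y].
Proof.
split; [exact: closed_commutant| exact: comm_sc| exact: commrD| exact: commrM].
Qed.

Lemma nrm_le_shift h s t : nrm (sc t - h) <= t -> t <= s -> nrm (sc s - h) <= s.
Proof.
move=> ht ts.
have -> : sc s - h = sc (s - t) + (sc t - h) by rewrite scB subrKA.
have := nrmD (sc (s - t)) (sc t - h); have := @nrm_sc_ge0 _ A (s - t); lra.
Qed.

(** The root is [tau - z] with [tau^2 = t], where [z] is the fixed point of
    [z |-> (z^2 + (t - h)) / (2 tau)], which is the equation
    [(tau - z)^2 = h].  The scalar majorant is the case [h = 0], whose fixed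
    point is [tau]; the root is psd because [|z| <= tau]. *)
Lemma psd_sqrt h t : star h = h -> 0 < t -> nrm (sc t - h) <= t ->
  exists k, [/\ psd k, k * k = h & forall M, real_subalgebra M -> M h -> M k].
Proof.
move=> sh t0 ht; pose tau := Num.sqrt t; pose c := (2 * tau)^-1.
have tau0 : 0 < tau by rewrite sqrtr_gt0.
have tauE : tau ^+ 2 = t by rewrite sqr_sqrtr // ltW.
have c0 : 0 < c by rewrite invr_gt0 mulr_gt0.
have cE : c * tau = 2^-1 by rewrite /c invfM -mulrA mulVf ?mulr1 // gt_eqF.
pose phi z := sc c * (z * z + (sc t - h)).
have phiB x y : phi x - phi y = sc c * (x * (x - y) + (x - y) * y).
  rewrite /phi -mulrBr opprD addrACA subrr addr0; congr (_ * _);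
  by rewrite mulrBr mulrBl subrKA.
have phin x y : nrm (phi x - phi y) <= c * (nrm x + nrm y) * nrm (x - y).
  rewrite phiB nrm_scM gtr0_norm // -mulrA ler_pM2l //.
  have := nrmD (x * (x - y)) ((x - y) * y).
  by have := nrmM x (x - y); have := nrmM (x - y) y; lra.
pose rho s := c * (s ^+ 2 + t).
have [||||z [phiz zB zM]] :=
  @majorized_fixpoint _ _ phi rho tau 1 (ltW tau0).
- move=> s /andP[s0 sB]; apply/andP; split.
    by rewrite mulr_ge0 ?addr_ge0 ?sqr_ge0 // ltW.
  have <- : c * (tau ^+ 2 + t) = tau.
    rewrite -tauE; transitivity (2 * (c * tau) * tau); first by ring.
    by rewrite cE; field.
  by rewrite ler_pM2l // lerD2r; apply: lerXn2r; rewrite // nnegrE // ltW.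
- by rewrite /phi /rho mulr0 expr0n !add0r nrm_scM gtr0_norm // ler_pM2l.
- move=> x y s t' yt xys _ _; apply: (le_trans (phin x y)).
  have -> : rho s - rho t' = c * ((s + t') * (s - t')) by rewrite /rho; ring.
  rewrite -mulrA ler_pM2l //; have := nrmD (x - y) y; rewrite subrK => xle.
  by apply: ler_pM; rewrite ?addr_ge0 ?nrm_ge0 //; lra.
- move=> x y xB yB; apply: (le_trans (phin x y)).
  apply: ler_wpM2r; first exact: nrm_ge0.
  have : c * (nrm x + nrm y) <= c * (tau + tau) by rewrite ler_pM2l // lerD.
  by rewrite [leRHS]mulrDr cE; lra.
exists (sc tau - z); split.
- split; last by exists tau; rewrite opprB addrC subrK.
  rewrite starB star_sc; congr (_ - _).
  apply: (zM _ closed_sa); first exact: star0.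
  move=> x /= sx; rewrite /phi starMr !(starD, starN, starMr, star_sc) sx sh.
  by rewrite scC.
- have e : sc (2 * tau) * z = z * z + (sc t - h).
    by rewrite -{1}phiz /phi mulrA -scM mulfV ?sc1 ?mul1r // mulf_neq0 ?gt_eqF.
  rewrite scM -mulrA -sc_double in e.
  rewrite mulrBr !mulrBl -(scC tau z) -scM -expr2 tauE opprB.
  apply: (addIr (sc tau * z + sc tau * z)); rewrite addrACA !subrK e.
  by rewrite (addrCA h) (addrC h) subrK addrC.
- move=> M MA Mh; have [Mc Msc MD MM] := MA.
  apply: real_subalgebraB => //; apply: zM => //; first by rewrite -sc0.
  move=> x Mx; apply: (MM) => //; apply: (MD); first exact: MM.
  exact: real_subalgebraB.
Qed.

(** Neumann series: the inverse is the fixed point of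
    [w |-> (1 + (t - x) w) / t], which is a right inverse and commutes with
    [x]. *)
Lemma inverse_near_sc x q t : nrm (sc t - x) <= q -> q < t ->
  exists w, x * w = 1 /\ w * x = 1.
Proof.
move=> xq qt; have q0 : 0 <= q by apply: le_trans xq; exact: nrm_ge0.
have t0 : 0 < t by exact: le_lt_trans qt.
have tV : 0 < t^-1 by rewrite invr_gt0.
pose y := sc t - x; pose phi w := sc t^-1 * (1 + y * w).
have phin u v : nrm (phi u - phi v) <= t^-1 * (q * nrm (u - v)).
  rewrite /phi -mulrBr opprD addrACA subrr add0r -mulrBr nrm_scM gtr0_norm //.
  rewrite ler_pM2l //; apply: (le_trans (nrmM _ _)).
  by apply: ler_wpM2r => //; exact: nrm_ge0.
have tq : 0 < t - q by lra.
pose rho s := t^-1 * (1 + q * s).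
have [|||||w [phiw _ wM]] :=
  @majorized_fixpoint _ _ phi rho (t - q)^-1 (t^-1 * q).
- by rewrite invr_ge0 ltW.
- move=> s /andP[s0 sB]; apply/andP; split.
    by rewrite mulr_ge0 ?addr_ge0 ?mulr_ge0 // ltW.
  rewrite ler_pdivrMl //; apply: (@le_trans _ _ (1 + q * (t - q)^-1)).
    by rewrite lerD2l ler_wpM2l.
  by rewrite le_eqVlt; apply/orP; left; apply/eqP; field; rewrite gt_eqF.
- rewrite /phi /rho !mulr0 !addr0 nrm_scM gtr0_norm // ler_pM2l //.
  exact: nrm1_le.
- move=> u v r s _ uv _ _; apply: (le_trans (phin u v)).
  have -> : rho r - rho s = t^-1 * (q * (r - s)) by rewrite /rho; ring.
  by rewrite ler_pM2l // ler_wpM2l.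
- by move=> u v _ _; rewrite -mulrA; exact: phin.
have xw : x * w = 1.
  have : sc t * w = 1 + y * w.
    by rewrite -{1}phiw /phi mulrA -scM mulfV ?sc1 ?mul1r // gt_eqF.
  move/eqP; rewrite -subr_eq => /eqP <-.
  by rewrite /y mulrBl opprB addrC subrK.
suff : [set v | GRing.comm x v] w by exists w; split=> //; rewrite -[RHS]xw.
apply: wM; first exact: closed_commutant.
  exact: commr0.
move=> u xu /=; apply: commrM; first exact: comm_sc.
apply: commrD; first exact: commr1.
apply: commrM => //; apply: commrD; first exact: comm_sc.
apply: commrN; exact: commr_refl.
Qed.

End SquareRoots.

(** * The cone of positive elements *)

Section PositiveCone.
Context {R : realType} {A : unitalCStarAlgType R}.
Implicit Types (x y z h k g w : A) (r s t e : R) (M : set A).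

Lemma psd_sa h : psd h -> star h = h. Proof. by case. Qed.

Lemma comm_subr_sqr x y : GRing.comm x y -> (x - y) * (x + y) = x * x - y * y.
Proof. by move=> xy; rewrite mulrBl !mulrDr -xy opprD addrA addrK. Qed.

Lemma psd_sqrt_ex h : psd h ->
  exists k, [/\ psd k, k * k = h & forall M, real_subalgebra M -> M h -> M k].
Proof.
case=> sh [t ht]; have t0 : 0 <= t by apply: le_trans ht; exact: nrm_ge0.
apply: (@psd_sqrt _ _ h (t + 1)); rewrite ?ltr_wpDl //.
by apply: (nrm_le_shift ht); lra.
Qed.

(** With [u = x + i g], one has [star u * u = x^2 + g^2], and [x] is the real
    part of [u], so [|x| <= |u|]. *)
Lemma sa_sumsq x g : star x = x -> star g = g -> GRing.comm x g ->
  nrm x ^+ 2 <= nrm (x * x + g * g).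
Proof.
move=> sx sg xg; pose i : A := 'i%C *: (1 : A); pose u := x + i * g.
have iC y : i * y = y * i by exact: scale1C.
have ii : i * i = -1.
  by rewrite -scale_mulE scalerA -expr2 sqr_i scaleN1r.
have si : star i = - i.
  rewrite /i starZ star1 -scaleNr; congr (_ *: _).
  by apply/eqP; rewrite eq_complex /= oppr0 !eqxx.
have su : star u = x - i * g by rewrite starD starMr sx sg si mulrN -iC.
have uu : star u * u = x * x + g * g.
  have xv : GRing.comm x (i * g) by apply: commrM => //; exact/esym/iC.
  rewrite su comm_subr_sqr // -mulrA [g * _]mulrA -iC !mulrA ii.
  by rewrite mulN1r mulNr opprK.
have xu : x + x = u + star u by rewrite su addrACA subrr addr0.
have : nrm (x + x) <= 2 * nrm u.
  by rewrite xu; have := nrmD u (star u); rewrite nrm_star; lra.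
rewrite sc_double nrm_scM gtr0_norm // ler_pM2l // => xu'.
by rewrite -uu nrm_cstar; apply: lerXn2r; rewrite ?nnegrE ?nrm_ge0.
Qed.

(** As [|t - (t - k^2)| <= t], there is a self-adjoint [g], commuting with [k],
    such that [g^2 = t - k^2].  Then [|t - k^2| = |g|^2 <= |g^2 + k^2| <= t]. *)
Lemma nrm_shift_sq k t : star k = k -> 0 < t -> nrm k ^+ 2 <= t ->
  nrm (sc t - k * k) <= t.
Proof.
move=> sk t0 kt.
have [||g [[sg _] gE gM]] := @psd_sqrt _ _ (sc t - k * k) t _ t0.
- by rewrite starB star_sc starMr sk.
- by rewrite opprB addrC subrK; apply: le_trans (nrmM _ _) _.
have kg : GRing.comm k g.
  apply: (gM [set y | GRing.comm k y] (commutant_subalgebra k)).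
  apply: commrD; first exact: comm_sc.
  by apply: commrN; apply: commrM; exact: commr_refl.
rewrite -gE nrm_sq_sa //.
have := sa_sumsq sg sk (commr_sym kg); rewrite gE subrK => /le_trans; apply.
exact/nrm_sc_ge0/ltW.
Qed.

(** Any [t >= |h|] serves in the definition of psd; a bound on [t] that does not
    depend on [h] is what limits require. *)
Lemma psd_nrm_le h t : psd h -> nrm h <= t -> nrm (sc t - h) <= t.
Proof.
move=> /psd_sqrt_ex [k [[sk _] <- _]]; rewrite nrm_sq_sa // => kt.
have [t0|t0] := ltP 0 t; first exact: nrm_shift_sq.
have k0 : k = 0.
  apply: nrm_eq0; apply/eqP; rewrite -sqrf_eq0 eq_le sqr_ge0 andbT.
  exact: le_trans t0.
have -> : t = 0 by apply/eqP; rewrite eq_le t0 (le_trans (sqr_ge0 (nrm k))).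
by rewrite k0 mulr0 subr0 sc0 nrm0.
Qed.

Lemma psd_sq k : star k = k -> psd (k * k).
Proof.
move=> sk; split; first by rewrite starMr sk.
exists (nrm k ^+ 2 + 1).
by apply: nrm_shift_sq => //; have := sqr_ge0 (nrm k); lra.
Qed.

Lemma psd_sc r : 0 <= r -> psd (sc r : A).
Proof. by move=> r0; split; [exact: star_sc|exists r; rewrite subrr nrm0]. Qed.

Lemma psdD h k : psd h -> psd k -> psd (h + k).
Proof.
move=> [sh [s hs]] [sk [t kt]]; split; first by rewrite starD sh sk.
exists (s + t); rewrite scD opprD addrACA.
by apply: le_trans (nrmD _ _) _; exact: lerD.
Qed.

(** With square roots [x], [y] of the factors, the product is the square of the
    self-adjoint element [x * y]. *)
Lemma psdM h k : psd h -> psd k -> GRing.comm h k -> psd (h * k).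
Proof.
move=> /psd_sqrt_ex [x [[sx _] xh xM]] /psd_sqrt_ex [y [[sy _] yk yM]] hk.
have xk : GRing.comm k x.
  apply: (xM [set z | _] (commutant_subalgebra k)); exact: commr_sym.
have xy : GRing.comm x y.
  apply: (yM [set z | _] (commutant_subalgebra x)); exact: commr_sym.
suff -> : h * k = x * y * (x * y) by apply: psd_sq; rewrite starMr sx sy -xy.
by rewrite -xh -yk -!mulrA; congr (_ * _); rewrite !mulrA xy.
Qed.

Lemma psdZ r h : 0 <= r -> psd h -> psd (sc r * h).
Proof. by move=> r0 hp; apply: psdM => //; [exact: psd_sc|exact: scC]. Qed.

Lemma psd_lim h : (forall e, 0 < e -> psd (h + sc e)) -> psd h.
Proof.
move=> hp; have sh : star h = h.
  have := psd_sa (hp 1 ltr01); rewrite starD star_sc; exact: addIr.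
split=> //; exists (nrm h + 1); apply/ler_addgt0Pl => e0 e0p.
pose e := Num.min e0 1; have ep : 0 < e by rewrite lt_min e0p ltr01.
have e1 : e <= 1 by rewrite ge_min lexx orbT.
have ee : e <= e0 by rewrite ge_min lexx.
have he : nrm (h + sc e) <= nrm h + 1.
  by apply: le_trans (nrmD _ _) _; have := @nrm_sc_ge0 _ A e (ltW ep); lra.
have := psd_nrm_le (hp e ep) he.
have := nrmD (sc (nrm h + 1) - (h + sc e)) (sc e); rewrite opprD addrA subrK.
have := @nrm_sc_ge0 _ A e (ltW ep); lra.
Qed.

Lemma sa_inv h w : star h = h -> h * w = 1 -> w * h = 1 -> star w = w.
Proof.
move=> sh hw wh; have sw : star w * h = 1 by rewrite -{1}sh -starMr hw star1.
by rewrite -[star w]mulr1 -hw mulrA sw mul1r.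
Qed.

Lemma comm_inv x h w :
  h * w = 1 -> w * h = 1 -> GRing.comm x h -> GRing.comm x w.
Proof.
move=> hw wh xh; rewrite /GRing.comm -[LHS]mul1r -wh -mulrA (mulrA h) -xh.
by rewrite -mulrA hw mulr1.
Qed.

Lemma psd_inv h w : psd h -> h * w = 1 -> w * h = 1 -> psd w.
Proof.
move=> hp hw wh; have [sh _] := hp; have sw := sa_inv sh hw wh.
have -> : w = h * (w * w) by rewrite mulrA hw mul1r.
apply: psdM => //; first exact: psd_sq.
by apply: commrM; rewrite /GRing.comm hw wh.
Qed.

(** The inverse [w] is bounded by some [t > 0], so [t - w] is psd, and
    [h - 1/t = h (t - w) / t] is a commuting product of psd elements. *)
Lemma psd_unit_shift h w : psd h -> h * w = 1 -> w * h = 1 ->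
  exists e, 0 < e /\ psd (h - sc e).
Proof.
move=> hp hw wh; have [sh _] := hp; have wp := psd_inv hp hw wh.
pose t := nrm w + 1; have t0 : 0 < t by rewrite ltr_wpDl // nrm_ge0.
have dp : psd (sc t - w).
  split; first by rewrite starB star_sc (psd_sa wp).
  by exists t; rewrite opprB addrC subrK lerDl.
exists t^-1; rewrite invr_gt0; split=> //.
have -> : h - sc t^-1 = sc t^-1 * (h * (sc t - w)).
  rewrite mulrBr hw mulrBr mulr1 -scC mulrA -scM mulVf ?gt_eqF //.
  by rewrite sc1 mul1r.
apply: psdZ; first by rewrite invr_ge0 ltW.
apply: psdM => //; apply: commrD; first exact: comm_sc.
by apply: commrN; rewrite /GRing.comm hw wh.
Qed.

(** The product [(t - x)(t + x) = t^2 - x^2] is psd, hence a square [g^2], and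
    [|x|^2 <= |x^2 + g^2| <= t^2]. *)
Lemma nrm_le_of_order x t : 0 <= t -> star x = x ->
  psd (sc t - x) -> psd (sc t + x) -> nrm x <= t.
Proof.
move=> t0 sx p1 p2.
have c : GRing.comm (sc t - x) (sc t + x).
  apply: commr_sym; apply: commrD; first exact: comm_sc.
  apply: commrN; apply: commr_sym.
  by apply: commrD; [exact: comm_sc|exact: commr_refl].
have [g [[sg _] gE gM]] := psd_sqrt_ex (psdM p1 p2 c).
have xg : GRing.comm x g.
  apply: (gM [set z | _] (commutant_subalgebra x)) => /=.
  apply: commrM; apply: commrD; try apply: commrN;
    by [exact: comm_sc|exact: commr_refl].
have := sa_sumsq sx sg xg.
have -> : x * x + g * g = sc (t ^+ 2).
  rewrite gE comm_subr_sqr; last exact: scC.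
  by rewrite addrC subrK -scM.
have := @nrm_sc_ge0 _ A (t ^+ 2) (sqr_ge0 t) => + /le_trans.
by move=> /[swap]/[apply]; rewrite ler_pXn2r ?nnegrE ?nrm_ge0.
Qed.

Lemma psd_near t x : star x = x -> nrm x <= t -> psd (sc t - x).
Proof.
move=> sx xt; split; first by rewrite starB star_sc sx.
by exists t; rewrite opprB addrC subrK.
Qed.

Lemma psd_add_unit k e : psd k -> 0 < e ->
  exists w, (k + sc e) * w = 1 /\ w * (k + sc e) = 1.
Proof.
move=> [sk [t kt]] e0; apply: (@inverse_near_sc _ _ _ t (t + e)); last by lra.
by rewrite scD opprD addrACA subrr addr0.
Qed.

(** Put [k' = k + e] with [e > 0], which is invertible with inverse [w].  Then
    [x^2 <= k'^2] still holds, so [(x w)^2 <= 1], which forces [|x w| <= 1];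
    thus [1 - x w] is psd and so is [k' (1 - x w) = k' - x].  Let [e] tend to
    [0]. *)
Lemma psd_sub_of_sq k x : psd k -> star x = x -> GRing.comm k x ->
  psd (k * k - x * x) -> psd (k - x).
Proof.
move=> kp sx kx kkxx; apply: psd_lim => e e0.
have [w [kw wk]] := psd_add_unit kp e0; set k' := k + sc e in kw wk.
have k'p : psd k' by apply: psdD => //; exact/psd_sc/ltW.
have sk' := psd_sa k'p; have sw := sa_inv sk' kw wk.
have xk' : GRing.comm x k' by apply: commrD; [exact: commr_sym|exact: comm_sc].
have xw : GRing.comm x w := comm_inv kw wk xk'.
have k'w : GRing.comm k' w by rewrite /GRing.comm kw wk.
have d : psd (k' * k' - x * x).
  have -> : k' * k' - x * x = (k * k - x * x) + (sc e * k' + sc e * k).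
    rewrite addrAC; congr (_ - _).
    rewrite {1}/k' mulrDl (_ : k * k' = k * k + sc e * k).
      by rewrite addrA addrAC.
    by rewrite mulrDr scC.
  by apply: psdD => //; apply: psdD; apply: psdZ => //; exact: ltW.
have cp : psd (1 - x * w * (x * w)).
  have -> : 1 - x * w * (x * w) = (k' * k' - x * x) * (w * w).
    rewrite mulrBl -(mulrA k') (mulrA k' w) kw mul1r kw; congr (_ - _).
    by rewrite -!mulrA; congr (_ * _); rewrite !mulrA xw.
  apply: psdM => //; first exact: psd_sq.
  apply: commr_sym; apply: commrD; last apply: commrN.
    by apply: commrM; apply: commr_sym; apply: commrM.
  by apply: commrM; apply: commr_sym; apply: commrM.
have sxw : star (x * w) = x * w by rewrite starMr sx sw xw.
have xw1 : nrm (x * w) <= 1.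
  have [g [[sg _] gE gM]] := psd_sqrt_ex cp.
  have := sa_sumsq sxw sg _; rewrite gE addrC subrK => H.
  have : nrm (x * w) ^+ 2 <= 1.
    apply: le_trans (H _) nrm1_le.
    apply: (gM [set z | _] (commutant_subalgebra _)) => /=.
    apply: commrD; first exact: commr1.
    by apply: commrN; apply: commrM; exact: commr_refl.
  by rewrite expr_le1 // nrm_ge0.
have -> : k - x + sc e = k' * (sc 1 - x * w).
  by rewrite mulrBr sc1 mulr1 mulrA -xk' -mulrA kw mulr1 addrAC.
apply: psdM => //; first exact: psd_near.
apply: commrD; first exact: comm_sc.
by apply: commrN; apply: commrM => //; exact: commr_sym.
Qed.

(** Otherwise the least [m >= 0] such that [h + m] is psd would be positive;
    [h + m] is invertible by the hypothesis on the spectrum, and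
    [psd_unit_shift] contradicts the choice of [m]. *)
Lemma positive_psd h : positive h -> psd h.
Proof.
move=> [sh spec].
have invh m : 0 < m -> exists w, (h + sc m) * w = 1 /\ w * (h + sc m) = 1.
  move=> m0; apply: contrapT => ninv.
  have /= := spec (- m)%:C%C; rewrite /spectrum /= ler0c => /(_ _).
  apply/not_implyP; split; last by apply/negP; rewrite -ltNge oppr_lt0.
  move=> inv; apply: ninv; move: inv.
  by rewrite /invertible rmorphN scaleNr opprK.
pose E := [set t : R | 0 <= t /\ psd (h + sc t)].
have En : E (nrm h).
  split; first exact: nrm_ge0.
  by rewrite addrC -[h]opprK; apply: psd_near; rewrite ?starN ?sh ?nrmN.
have infE : has_inf E by split; [exists (nrm h)|exists 0 => t []].
pose m := inf E; have m0 : 0 <= m.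
  by apply: lb_le_inf; [exists (nrm h)|move=> t []].
have hm : psd (h + sc m).
  apply: psd_lim => e e0; have [t [t0 ht] tm] := inf_adherent e0 infE.
  have -> : h + sc m + sc e = h + sc t + sc (m + e - t).
    by rewrite -!addrA -!scD; congr (_ + sc _); ring.
  by apply: psdD => //; apply: psd_sc; rewrite -/m in tm; lra.
have [m00|m_gt0] := eqVneq m 0; first by move: hm; rewrite m00 sc0 addr0.
have mp : 0 < m by rewrite lt_neqAle eq_sym m_gt0.
have [w [hw wh]] := invh m mp.
have [e [e0 he]] := psd_unit_shift hm hw wh.
have {}he s : 0 < s -> s <= e -> psd (h + sc (m - s)).
  move=> s0 se; have -> : h + sc (m - s) = h + sc m - sc e + sc (e - s).
    by rewrite -!addrA -!scN -!scD; congr (_ + sc _); ring.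
  by apply: psdD => //; apply: psd_sc; lra.
pose s := Num.min e m; have s0 : 0 < s by rewrite lt_min e0.
have : E (m - s).
  split; first by rewrite subr_ge0 ge_min lexx orbT.
  by apply: he => //; rewrite ge_min lexx.
by move=> /(ge_inf infE.2); rewrite -/m; lra.
Qed.

(** For [z = a + i b] with [b <> 0], the element [h - z] divides
    [(h - a)^2 + b^2], which is a psd element plus a positive scalar, hence
    invertible; for [z = a < 0], [h - a] itself is of this form. *)
Lemma psd_positive h : psd h -> positive h.
Proof.
move=> hp; have sh := psd_sa hp; split=> // z /= zspec.
rewrite lecE /=; apply: contrapT => nz; apply: zspec.
pose a := complex.Re z; pose b := complex.Im z.
have zE : z *: (1 : A) = sc a + 'i%C *: sc b.
  by rewrite {1}[z]complexE scalerDl /sc scalerA.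
have [b0|bn0] := eqVneq b 0.
  have a0 : 0 < - a.
    rewrite oppr_gt0 ltNge; apply/negP => a0; apply: nz.
    by rewrite -/b b0 eqxx.
  rewrite zE b0 sc0 scaler0 addr0 -scN; exact: psd_add_unit.
pose j := 'i%C *: sc b : A; pose x := h - sc a.
have b2 : 0 < b ^+ 2 by rewrite exprn_even_gt0.
have sx : star x = x by rewrite starB sh star_sc.
have [w [xw wx]] := psd_add_unit (psd_sq sx) b2.
have jE : j = ('i%C *: (1 : A)) * sc b by rewrite -scale_mulE.
have xj : GRing.comm x j.
  by rewrite jE; apply: commrM; [exact/esym/scale1C|exact: comm_sc].
have jj : j * j = - sc (b ^+ 2).
  rewrite jE mulrA -[X in X * _]mulrA scC mulrA -scale_mulE scalerA -expr2.
  by rewrite sqr_i scaleN1r mulN1r mulNr -scM.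
have f1 : (x - j) * (x + j) = x * x + sc (b ^+ 2).
  by rewrite comm_subr_sqr // jj opprK.
have f2 : (x + j) * (x - j) = x * x + sc (b ^+ 2).
  rewrite -{1}[j]opprK comm_subr_sqr ?mulrNN ?jj ?opprK //; exact: commrN.
have -> : h - z *: (1 : A) = x - j by rewrite zE opprD addrA.
exists ((x + j) * w); rewrite mulrA f1; split=> //.
have wj : GRing.comm (x - j) w.
  apply: (comm_inv xw wx); rewrite /GRing.comm -[in LHS]f2 -[in RHS]f1.
  by rewrite mulrA.
by rewrite -mulrA -wj mulrA f2.
Qed.

End PositiveCone.

(** * Generated C*-subalgebras and the minimum with a scalar *)

Section Minimum.
Context {R : realType} {A : unitalCStarAlgType R}.
Implicit Types (a b x y z k : A) (r e : R) (S T M : set A).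

Lemma subspace_lin M (c : R[i]) x y : selfadjoint_subspace M ->
  M x -> M y -> M (c *: x + y).
Proof.
by move=> [[_ lin] _] Mx My; apply/set_mem; apply: lin; apply/mem_set.
Qed.

Lemma cstar_generated_subalgebra T : cstar_subalgebra (cstar_generated T).
Proof.
split.
- split; last first.
    by move=> a Ta M MT; have [[[_ Mst] _ _] _] := MT; apply: Mst; exact: Ta.
  split; first by apply/mem_set => M [[[[M0 _] _] _ _] _]; exact/set_mem.
  move=> c x y /set_mem Tx /set_mem Ty; apply/mem_set => M MT.
  have [[MS _ _] _] := MT.
  by apply: subspace_lin => //; [exact: Tx|exact: Ty].
- move=> a b Ta Tb M MT; have [[_ MM _] _] := MT.
  by apply: MM; [exact: Ta|exact: Tb].
- by apply: closed_bigI => M [[_ _ Mc] _].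
Qed.

(** The commutant of a self-adjoint set is a C*-subalgebra. *)
Lemma cstar_generated_comm S T :
  selfadjoint_subspace S -> commutes_with S T ->
  forall s x : A, S s -> cstar_generated T x -> GRing.comm s x.
Proof.
move=> [_ Sst] ST s x Ss Tx.
suff : [set y | forall s : A, S s -> GRing.comm s y] x by exact.
apply: Tx; split; last by move=> y Ty s' Ss'; exact: ST.
split.
- split; last first.
    move=> y Cy s' Ss'; have := Cy _ (Sst _ Ss').
    by rewrite /GRing.comm => e; rewrite -[s']starK -!starMr e.
  split; first by apply/mem_set => s' _; exact: commr0.
  move=> c y z /set_mem Cy /set_mem Cz; apply/mem_set => s' Ss'.
  apply: commrD; last exact: Cz.
  by rewrite scale_mulE; apply: commrM; [exact/esym/scale1C|exact: Cy].
- by move=> y z Cy Cz s' Ss'; apply: commrM; [exact: Cy|exact: Cz].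
- apply: approx_closed => y Hy s' Ss'.
  apply: (closed_approx (@closed_commutant _ _ s')) => e /Hy [z [Cz yz]].
  by exists z; split=> //=; exact: Cz.
Qed.

Lemma cstar_subalgebra_real M : cstar_subalgebra M -> M 1 -> real_subalgebra M.
Proof.
move=> [MS MM Mc] M1; split=> //.
- move=> r; rewrite /sc -[_ *: _]addr0; apply: subspace_lin => //.
  by case: MS => -[M0 _] _; exact/set_mem.
- by move=> x y Mx My; rewrite -[x]scale1r; exact: subspace_lin.
Qed.

(** The witness is [min(b, c)].  The lower bound [a] commutes with [b] but may
    lie outside [M]. *)
Lemma min_exists M a b (c : R) : real_subalgebra M -> 0 <= c ->
  star a = a -> M b -> star b = b -> GRing.comm a b -> psd (b - a) ->
  psd (sc c - a) -> psd (sc c + a) ->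
  exists b', [/\ M b', star b' = b', nrm b' <= c, psd (b' - a) & psd (b - b')].
Proof.
move=> MA c0 sa Mb sb ab pp qp q'p; have [_ Msc MD MM] := MA.
set p := b - a in pp; set q := sc c - a in qp.
pose x := p - q; have xE : x = b - sc c by rewrite /x /p /q opprB subrKA.
have sx : star x = x by rewrite xE starB sb star_sc.
have Mx : M x by rewrite xE; exact: real_subalgebraB.
have [k [kp kk kM]] := psd_sqrt_ex (psd_sq sx).
have sk := psd_sa kp; have Mk : M k by apply: kM => //; exact: MM.
have comk y : GRing.comm y x -> GRing.comm y k.
  move=> yx; apply: (kM [set z | GRing.comm y z] (commutant_subalgebra y)).
  exact: commrM.
have kx : GRing.comm k x by exact/commr_sym/comk/commr_refl.
(* [k] is [|b - c|], so both [b - b'] and [c - b'] come out as nonnegative. *)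
have kmx : psd (k - x).
  by apply: psd_sub_of_sq => //; rewrite kk subrr -sc0; exact: psd_sc.
have kpx : psd (k + x).
  rewrite -[x]opprK; apply: psd_sub_of_sq; rewrite ?starN ?sx //.
    exact: commrN.
  by rewrite mulrNN kk subrr -sc0; exact: psd_sc.
have qC y : GRing.comm y a -> GRing.comm q y.
  move=> ya; apply: commr_sym.
  by apply: commrD; [exact: comm_sc|exact: commrN].
have pq : GRing.comm p q.
  apply: commr_sym; apply: commrD; first exact/qC/commr_sym.
  exact/commrN/qC/commr_refl.
have spq : psd (p + q - k).
  have cx : GRing.comm (p + q) x.
    apply: commr_sym; apply: commrD; apply: commr_sym.
      by apply: commrD; [exact: commr_refl|exact: commrN].
    by apply: commrD; [exact: commr_sym|exact/commrN/commr_refl].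
  apply: psd_sub_of_sq => //; [exact: psdD|exact: comk|].
  have -> : (p + q) * (p + q) - k * k = sc 4 * (p * q); last first.
    by apply: psdZ => //; exact: psdM.
  have e1 : p + q - x = sc 2 * q.
    by rewrite -sc_double opprB [p + q]addrC addrACA subrr addr0.
  have e2 : p + q + x = sc 2 * p by rewrite -sc_double addrACA subrr addr0.
  rewrite kk -comm_subr_sqr // e1 e2 -mulrA [q * _]mulrA -scC.
  rewrite -[sc 2 * q * p]mulrA.
  by rewrite mulrA -scM -pq; congr (sc _ * _); ring.
pose b' := sc 2^-1 * (b + sc c - k).
have half y : y = sc 2^-1 * (y + y).
  by rewrite sc_double mulrA -scM mulVf ?sc1 ?mul1r ?pnatr_eq0.
have b'a : b' - a = sc 2^-1 * (p + q - k).
  rewrite {1}(half a) -mulrBr; congr (_ * _).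
  by rewrite /p /q addrAC addrACA -opprD.
have bb' : b - b' = sc 2^-1 * (k + x).
  rewrite {1}(half b) -mulrBr; congr (_ * _).
  by rewrite !opprD opprK xE addrA addrA addrK addrC addrA addrC addrA.
have cb' : sc c - b' = sc 2^-1 * (k - x).
  rewrite {1}(half (sc c)) -mulrBr; congr (_ * _).
  by rewrite xE !opprB (addrC b) opprD addrCA addrACA subrr add0r.
have sb' : star b' = b'.
  by rewrite starMr !(starB, starD) star_sc star_sc sb sk -scC.
have h0 : 0 <= 2^-1 :> R by lra.
have b'ap : psd (b' - a) by rewrite b'a; exact: psdZ.
exists b'; split=> //.
- by apply: MM => //; apply: real_subalgebraB => //; exact: MD.
- apply: nrm_le_of_order => //; first by rewrite cb'; exact: psdZ.
  rewrite addrC -[b'](subrK a) -addrA (addrC a); exact: psdD.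
- by rewrite bb'; exact: psdZ.
Qed.

End Minimum.

Theorem proposition5p4 (R : realType) (A : unitalCStarAlgType R)
    (S T : set A)
    (hS : selfadjoint_subspace S)
    (hT : selfadjoint_subspace T)
    (hT1 : T 1)
    (hST : commutes_with S T) :
  unperforated S (cstar_generated T).
Proof.
have WA := cstar_generated_subalgebra T; have [WS _ _] := WA.
split=> // a b Sa sa Wb sb ab.
have W1 : cstar_generated T 1 by move=> M [_ TM]; exact: TM.
have ca : psd (sc (nrm a) - a) by exact: psd_near.
have ca' : psd (sc (nrm a) + a).
  by rewrite -[a in _ + a]opprK; apply: psd_near; rewrite ?starN ?nrmN ?sa.
have [b' [Wb' sb' b'a ab' b'b]] := min_exists (cstar_subalgebra_real WA W1)
  (nrm_ge0 a) sa Wb sb (cstar_generated_comm hS hST Sa Wb) (positive_psd ab)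
  ca ca'.
exists b'; split=> //; first by rewrite !normE lecR.
- exact: psd_positive.
- exact: psd_positive.
Qed.
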